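(* In the Bayesian $k$-armed bandit problem described in the context, suppose $P_\mu$ is the Bernoulli distribution with mean $\mu$ and the prior $\Gamma$ is $1$-regular with constants $0<c_0<C_0$. Then for $k\ge(30\log T)/c_0$, $$BR_{T,k}(\mathrm{Greedy})\le1+\frac{15T\log T}{kc_0}+\frac{3C_0k}{C_1}\bigl(5+\log(kc_0/5)-\log\log T\bigr),$$ where $C_1=(1-e^{-1})/2$. Furthermore, the Bayesian regret of SS-Greedy executed with subsampling size $m=\Theta(\sqrt T)$ is $\tilde O(\sqrt T)$.
   Context: Bayesian $k$-armed bandit: horizon $T$, arms $[k]$, $P_\mu$ reward distribution of mean $\mu\in[0,1]$; prior $\Gamma$ on $[0,1]$ with density; means i.i.d. $\sim\Gamma$; pulling arm $i$ at time $t$ gives $Y_{it}\sim P_{\mu_i}$ independently, only the pulled reward observed. $R_T(\pi\mid\bm\mu)=T\max_i\mu_i-\sum_t\mathbb{E}[\mu_{a_t}\mid\pi]$, $BR_{T,k}(\pi)=\mathbb{E}[R_T(\pi\mid\bm\mu)]$. $1$-regular: $c_0\epsilon\le\mathbb{P}_\Gamma(\mu>1-\epsilon)\le\mathbb{P}_\Gamma(\mu\ge1-\epsilon)\le C_0\epsilon$ for all $\epsilon\in(0,1]$. Greedy: pull each arm once ($a_t=t$ for $t\le k$), then pull the arm with the largest empirical mean reward. SS-Greedy with parameter $m$: draw $m$ arms uniformly without replacement from $[k]$ and run Greedy on them. $\tilde O$ hides polylogarithmic factors in $T$ and constants. *)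

(* Defs.v *)
From HB Require Import structures.
From mathcomp Require Import all_boot all_order all_algebra.
From mathcomp Require Import all_classical all_reals all_analysis.
Set Implicit Arguments. Unset Strict Implicit. Unset Printing Implicit Defensive.
Import Order.TTheory GRing.Theory Num.Theory.
Local Open Scope classical_set_scope.
Local Open Scope ring_scope.

(* Bayesian k-armed bandit with Bernoulli rewards.
   A reward table w assigns to each (arm i, time t) the reward Y_{it} in {0,1};
   pulling arm i at time t reveals w (i,t). *)

Section Bandit.
Variables (R : realType) (k T : nat).

Definition table := {ffun 'I_k * 'I_T -> bool}.

(* reward Y_{it} (0 outside the horizon, never used) *)
Definition rew (w : table) (i : 'I_k) (t : nat) : bool :=
  match @insub nat (fun t => t < T)%N _ t with
  | Some t' => w (i, t')
  | None => false
  end.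

Definition emp (w : table) (h : seq 'I_k) (i : 'I_k) : R :=
  (\sum_(t < size h | nth i h t == i) ((rew w i t : nat)%:R : R))
    / (count_mem i h)%:R.

Definition argbest (f : 'I_k -> R) (x : 'I_k) (s : seq 'I_k) : 'I_k :=
  foldl (fun b i => if f b < f i then i else b) x s.

Definition gnext (s : seq 'I_k) (w : table) (h : seq 'I_k) (t : nat)
  : option 'I_k :=
  match s with
  | [::] => None
  | i0 :: s' => Some (if (t < size s)%N then nth i0 s t
                      else argbest (emp w h) i0 s')
  end.

Fixpoint gacts (s : seq 'I_k) (w : table) (t : nat) : seq 'I_k :=
  match t with
  | 0 => [::]
  | t'.+1 => let h := gacts s w t' in
             match gnext s w h t' with
             | Some a => rcons h a
             | None => h
             end
  end.

Definition tprob (mu : nat -> R) (w : table) : R :=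
  \prod_(p : 'I_k * 'I_T) (if w p then mu p.1 else 1 - mu p.1).

Definition exp_rew (mu : nat -> R) (s : seq 'I_k) : R :=
  \sum_(w : table) tprob mu w * \sum_(a <- gacts s w T) mu a.

Definition regret (mu : nat -> R) (s : seq 'I_k) : R :=
  T%:R * (\big[Num.max/0]_(i < k) mu i) - exp_rew mu s.

End Bandit.

(* iterated integral with respect to Gamma^{(x) n}: means mu_0, ..., mu_{n-1}
   i.i.d. ~ P *)
Fixpoint iint (R : realType) (P : probability R R) (n : nat)
  (F : (nat -> R) -> \bar R) : \bar R :=
  match n with
  | 0 => F (fun _ => 0)
  | n'.+1 => (\int[P]_x iint P n'
                (fun v => F (fun j => if j is j'.+1 then v j' else x)))%E
  end.

Definition BR_greedy (R : realType) (P : probability R R) (T k : nat) : \bar R :=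
  iint P k (fun mu => (regret T mu (enum 'I_k))%:E).

Definition BR_ssgreedy (R : realType) (P : probability R R) (T k m : nat)
  : \bar R :=
  iint P k (fun mu =>
    ((\sum_(S : {set 'I_k} | #|S| == m) regret T mu (enum S))
       / ('C(k, m))%:R)%:E).

Definition regular1 (R : realType) (P : probability R R) (c0 C0 : R) : Prop :=
  forall e : R, 0 < e <= 1 ->
    ((c0 * e)%:E <= P [set x : R | (1 - e < x)%R])%E /\
    (P [set x : R | (1 - e < x)%R] <= P [set x : R | (1 - e <= x)%R])%E /\
    (P [set x : R | (1 - e <= x)%R] <= (C0 * e)%:E)%E.

(* Main.v *)
Require Import Defs.
From HB Require Import structures.
From mathcomp Require Import all_boot all_order all_algebra.
From mathcomp Require Import all_classical all_reals all_analysis.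
From mathcomp Require Import measurable_realfun ring lra.
Import Order.TTheory GRing.Theory Num.Theory.
Local Open Scope classical_set_scope.
Local Open Scope ring_scope.

(* Put delta = 5 log T / (k c0) <= 1/6 and call an arm good if its mean exceeds
   1 - delta. With probability at least 1/5 the empirical mean of a good arm
   never drops below 1 - 2 delta, so by 1-regularity the probability that every
   good arm drops is at most (1 - c0 delta / 5)^k <= 1/T. Otherwise, after the
   first pull of each arm, Greedy only pulls arms with empirical mean at least
   1 - 2 delta: an arm of mean at least 1 - 3 delta costs at most 3 delta per
   pull, and by a Chernoff bound any other arm is pulled so rarely that its
   total cost is at most 30.

   Since pulls are adaptive, both probability estimates are run through
   functions of the current scores of the arms that are supermartingales under
   any choice of the pulled arm: the product over good arms of 1 - (survival
   probability), and the sum over bad arms of 30 exp (score / 2). *)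

(** * Integrating bounds of product form against the i.i.d. prior *)

(* f need not be measurable: replacing H by +oo off D gives an everywhere upper
   bound, and the integral of a nonnegative function is a supremum over simple
   functions below it. *)
Lemma integral_le_off_null (d : measure_display) (X : measurableType d)
    (R : realType) (mu : {measure set X -> \bar R}) (D : set X)
    (f H : X -> \bar R) :
  measurable D -> mu (~` D) = 0%E -> measurable_fun [set: X] H ->
  (forall x, 0 <= H x)%E -> (forall x, D x -> f x <= H x)%E ->
  (\int[mu]_x f x <= \int[mu]_x H x)%E.
Proof.
move=> mD D0 mH H0 fH.
pose H' := patch (cst +oo%E) D H.
have H'0 x : (0 <= H' x)%E by rewrite /H' /patch; case: ifPn => // _; rewrite leey.
have -> : (\int[mu]_x H x = \int[mu]_x H' x)%E.
  apply: ge0_ae_eq_integral => //.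
  - rewrite /H' -(setUv D); apply/measurable_funU => //; first exact: measurableC.
    split.
      by apply: (eq_measurable_fun H) => [x xD|]; 
        [rewrite /patch xD | exact: measurable_funTS].
    apply: (eq_measurable_fun (cst +oo%E)) => [x|]; last exact: measurable_cst.
    by rewrite inE => /= xD; rewrite /patch memNset.
  - exists (~` D); split => //; first exact: measurableC.
    by move=> x /= nx Dx; apply: nx => _; rewrite /H' /patch mem_set.
rewrite integralE.
apply: (@le_trans _ _ (\int[mu]_x (f^\+ x))%E).
  by rewrite geeDl// leeNl oppe0; apply: integral_ge0.
rewrite !ge0_integralTE//; apply: ereal_sup_le => _ [h hf <-].
exists h => // x; apply: (le_trans (hf x)).
rewrite /= /H' funeposE /patch; case: ifPn => [|_]; last by rewrite leey.
by rewrite inE => Dx; rewrite ge_max fH// H0.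
Qed.

(** Sums of products are stable under integration in one coordinate: each integration turns a factor
    [phi s j] into its mean [q s j]. Only the majorant of [F] is ever integrated explicitly. *)
Lemma iint_le_sum_prod (R : realType) (P : probability R R) (n : nat)
    (I : finType) (F : (nat -> R) -> \bar R) (c : R) (d : I -> R)
    (phi : I -> nat -> R -> R) (q : I -> nat -> R) :
  P [set` `[0%R, 1%R]] = 1%E ->
  0 <= c -> (forall s, 0 <= d s) ->
  (forall s j, measurable_fun setT (phi s j)) ->
  (forall s j x, 0 <= phi s j x) ->
  (forall s j, (\int[P]_x (phi s j x)%:E)%E = (q s j)%:E) ->
  (forall v, (forall j, (j < n)%N -> 0 <= v j <= 1) ->
     (F v <= (c + \sum_s d s * \prod_(j < n) phi s j (v j))%:E)%E) ->
  (iint P n F <= (c + \sum_s d s * \prod_(j < n) q s j)%:E)%E.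
Proof.
move=> P01 c0; elim: n F d phi q => [|n IH] F d phi q d0 mphi phi0 qE FH /=.
  apply: (le_trans (FH _ _)) => //.
  by rewrite lee_fin lerD2l ler_sum// => s _; rewrite !big_ord0.
have q0 s j : 0 <= q s j by rewrite -lee_fin -qE; apply: integral_ge0 => x _; rewrite lee_fin.
pose H x := c + \sum_s d s * (phi s 0%N x * \prod_(j < n) q s j.+1).
have mH : measurable_fun setT H.
  apply: measurable_funD => //; apply: measurable_sum => s.
  apply: measurable_funM => //; exact: measurable_funM.
apply: (@le_trans _ _ (\int[P]_x (H x)%:E)%E).
  apply: (@integral_le_off_null _ _ R P [set` `[0%R, 1%R]] _ (fun x => (H x)%:E)) => //.
  - transitivity (1 - P [set` `[0%R, 1%R]])%E; first exact: probability_setC.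
    by rewrite P01 subee.
  - exact/measurable_EFinP.
  - move=> x; rewrite lee_fin addr_ge0// sumr_ge0// => s _.
    by rewrite !mulr_ge0// prodr_ge0.
  move=> x; rewrite /= in_itv/= => x01.
  (* With the first mean fixed at [x], its factor is absorbed into the weights [d]. *)
  have := @IH (fun v => F (fun j => if j is j'.+1 then v j' else x))
     (fun s => d s * phi s 0%N x) (fun s j => phi s j.+1) (fun s j => q s j.+1).
  rewrite /H; under [in X in _ -> X]eq_bigr do rewrite mulrA.
  apply => //.
  - by move=> s; rewrite mulr_ge0.
  move=> v v01; apply: (le_trans (FH _ _)); first by case.
  rewrite lee_fin lerD2l; apply: ler_sum => s _; rewrite -mulrA big_ord_recl/=.
  exact: lexx.
rewrite /H le_eqVlt; apply/orP; left; apply/eqP.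
under eq_integral do rewrite EFinD -sumEFin.
have m1 s : measurable_fun setT
   (fun x => (d s * (phi s 0%N x * \prod_(j < n) q s j.+1))%:E).
  apply/measurable_EFinP; apply: measurable_funM => //; exact: measurable_funM.
have p1 s x : (0 <= (d s * (phi s 0%N x * \prod_(j < n) q s j.+1))%:E)%E.
  by rewrite lee_fin !mulr_ge0// prodr_ge0.
rewrite ge0_integralD//=; last 2 first.
- by move=> x _; apply: sume_ge0.
- by apply: emeasurable_sum => s.
rewrite integral_cst// [X in (_ * X)%E](probability_setT P) mule1.
rewrite ge0_integral_sum//.
rewrite EFinD -sumEFin; congr (_ + _)%E; apply: eq_bigr => s _.
under eq_integral do rewrite mulrC -mulrA EFinM.
rewrite ge0_integralZr//; last 3 first.
- exact/measurable_EFinP.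
- by move=> x _; rewrite lee_fin.
- by rewrite lee_fin mulr_ge0// prodr_ge0.
rewrite qE -EFinM; congr EFin; rewrite big_ord_recl/=.
by rewrite [X in _ * X]mulrC mulrCA.
Qed.

(** * Numerical bounds on the exponential *)

Lemma expRN_le (R : realType) (x b : R) : 0 <= x -> 1 <= b * (1 + x) ->
  expR (- x) <= b.
Proof.
move=> x0 bx; rewrite expRN -[leLHS]mul1r ler_pdivrMr ?expR_gt0//.
apply: (le_trans bx); apply: ler_wpM2l (expR_ge1Dx _); nra.
Qed.

(** The bound [1 + x <= expR x] is too crude at the full exponent; applied to a sixth of it and
    raised to the sixth power it suffices. The next two lemmas proceed likewise. *)
Lemma expR1_le3 (R : realType) : expR (1 : R) <= 3.
Proof.
have h0 : (5 / 6 : R) <= expR (- (1 / 6)) by apply: le_trans (expR_ge1Dx _); lra.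
have h : (5 / 6 : R) ^+ 6 <= expR (- (1 / 6)) ^+ 6.
  by rewrite lerXn2r ?nnegrE ?expR_ge0//; lra.
rewrite -expRM_natl in h; rewrite -[3]invrK -[expR 1]invrK -expRN lef_pV2 ?posrE ?expR_gt0//.
have -> : - 1 = 6%:R * - (1 / 6) :> R by field.
apply: le_trans h; lra.
Qed.

Lemma expRN1_le (R : realType) : expR (- 1 : R) <= 2 / 5.
Proof.
have h0 : expR (- (1 / 6)) <= 6 / 7 :> R by apply: expRN_le; lra.
have h : expR (- (1 / 6)) ^+ 6 <= ((6 / 7) ^+ 6 : R).
  by rewrite lerXn2r ?nnegrE ?expR_ge0//; lra.
move: h; rewrite -expRM_natl.
have -> : 6%:R * - (1 / 6) = - 1 :> R by field.
move=> h; apply: (le_trans h); lra.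
Qed.

Lemma expRN_half_le (R : realType) : expR (- (1 / 2) : R) <= 63 / 100.
Proof.
have h0 : expR (- (1 / 8)) <= 8 / 9 :> R by apply: expRN_le; lra.
have h : expR (- (1 / 8)) ^+ 4 <= ((8 / 9) ^+ 4 : R).
  by rewrite lerXn2r ?nnegrE ?expR_ge0//; lra.
move: h; rewrite -expRM_natl.
have -> : 4%:R * - (1 / 8) = - (1 / 2) :> R by field.
move=> h; apply: (le_trans h); lra.
Qed.

(** * One-step inequalities for the scores of good and bad arms *)

Section survival.
Context {R : realType}.
Implicit Types x p delta : R.

(* A lower bound on the probability that a walk started at x, with steps
   2 delta and, with probability p <= delta, 2 delta - 1, stays nonnegative.
   The exponential bound 1 - expR (- x) vanishes at 0; on [0, 1[ the affine
   bound only counts walks without a down step until they reach [1, 4/3[, where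
   it is at most 3/5 <= 1 - expR (- 1). *)
Definition surv_low x : R := if 0 <= x < 1 then (1 + 3 / 2 * x) / 5 else 0.
Definition surv x : R := Num.max 0 (Num.max (1 - expR (- x)) (surv_low x)).

Lemma surv_ge0 x : 0 <= surv x.
Proof. by rewrite le_max lexx. Qed.

Lemma surv_le1 x : surv x <= 1.
Proof.
rewrite !ge_max ler01 /= gerBl expR_ge0 /= /surv_low.
by case: ifPn => //; lra.
Qed.

Lemma surv0 : 1 / 5 <= surv 0.
Proof. by rewrite !le_max /surv_low lexx ltr01 mulr0 addr0 lexx !orbT. Qed.

Lemma surv_neg x : x < 0 -> surv x = 0.
Proof.
move=> x0; apply/eqP; rewrite eq_le surv_ge0 andbT !ge_max lexx /=.
rewrite /surv_low (lt_geF x0) /= lexx andbT subr_le0.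
by apply: le_trans (expR_ge1Dx _); lra.
Qed.

Lemma surv_step p delta x : 0 <= p <= delta -> delta <= 1 / 6 ->
  surv x <= (1 - p) * surv (x + 2 * delta) + p * surv (x + (2 * delta - 1)).
Proof.
move=> /andP[p0 pd] d6.
have ge y : 1 - expR (- y) <= surv y by rewrite !le_max lexx orbT.
have A y : 0 <= p * surv y by rewrite mulr_ge0 ?surv_ge0.
have B y : 0 <= (1 - p) * surv y by rewrite mulr_ge0 ?surv_ge0//; lra.
rewrite {1}/surv !ge_max addr_ge0//=; apply/andP; split.
  apply: (@le_trans _ _ ((1 - p) * (1 - expR (- (x + 2 * delta))) +
      p * (1 - expR (- (x + (2 * delta - 1)))))).
    have -> : - (x + (2 * delta - 1)) = - x + - (2 * delta) + 1 by ring.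
    have -> : - (x + 2 * delta) = - x + - (2 * delta) by ring.
    rewrite !expRD.
    (* Since e <= 3, the bracket is at most 1 + 2p <= 1 + 2 delta <= exp (2 delta). *)
    have h : expR (- (2 * delta)) * (1 - p + p * expR 1) <= 1.
      rewrite expRN ler_pdivrMl ?expR_gt0// mulr1.
      apply: le_trans (expR_ge1Dx _).
      have := ler_wpM2l p0 (expR1_le3 R); lra.
    have := ler_wpM2l (expR_ge0 (- x)) h; lra.
  by apply: lerD; apply: ler_wpM2l; rewrite ?ge//; lra.
rewrite {1}/surv_low; case: ifPn => [/andP[x0 x1]|_]; last by rewrite addr_ge0.
rewrite -[leLHS]addr0; apply: lerD => //.
have h : (1 + 3 / 2 * (x + 2 * delta)) / 5 <= surv (x + 2 * delta).
  have [y1|y1] := ltP (x + 2 * delta) 1.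
    by rewrite !le_max /surv_low y1 andbT ifT ?lexx ?orbT//; lra.
  apply: le_trans (ge _).
  have : expR (- (x + 2 * delta)) <= expR (- 1) by rewrite ler_expR; lra.
  have := expRN1_le R; lra.
(* The down step has been discarded. As p <= delta and x < 1, it suffices that 5/2 <= 3 (1 - delta),
   which is exactly delta <= 1/6. *)
apply: le_trans (ler_wpM2l _ h); last lra.
nra.
Qed.

(** The Chernoff step for an arm with failure probability [x]: the left side is the mean factor
    gained by exp (score / 2) in one pull. The growth rate delta < x / 3 loses to the decay rate
    37/100 x, and the difference 11/300 x slightly exceeds x / 30. *)
Lemma pull_mgf_le x delta : 0 <= delta -> 3 * delta < x -> x <= 1 ->
  (1 - x) * expR (delta) + x * expR (delta - 1 / 2) <= 1 - x / 30.
Proof.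
move=> d0 dx x1; have -> : (1 - x) * expR delta + x * expR (delta - 1 / 2) =
  expR delta * (1 - x + x * expR (- (1 / 2))) by rewrite expRD; ring.
have a0 : 0 <= expR delta by exact: expR_ge0.
have H := expRN_half_le R.
have d1 : expR delta <= expR (x / 3) by rewrite ler_expR; lra.
have e1 : 1 - x + x * expR (- (1 / 2)) <= expR (- (37 / 100 * x)).
  apply: le_trans (expR_ge1Dx _).
  have := ler_wpM2l (ltac:(lra) : 0 <= x) H; lra.
apply: (@le_trans _ _ (expR (x / 3) * expR (- (37 / 100 * x)))).
  apply: ler_pM => //.
  have := mulr_ge0 (ltac:(lra) : 0 <= x) (expR_ge0 (- (1 / 2) : R)); lra.
rewrite -expRD (_ : _ + _ = - (11 / 300 * x)); last by field.
by apply: expRN_le; nra.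
Qed.

End survival.

(** * Revealing one reward of the random table *)

Section reward_table.
Context {R : realType} {k T : nat}.
Implicit Types (mu : nat -> R) (w : table k T).

Definition flip (p : 'I_k * 'I_T) w : table k T := [ffun q => (q == p) (+) w q].

Lemma flipK p : involutive (flip p).
Proof. by move=> w; apply/ffunP => q; rewrite !ffunE addbA addbb. Qed.

Lemma flip_same p w : flip p w p = ~~ w p.
Proof. by rewrite ffunE eqxx. Qed.

Lemma flip_other p q w : q != p -> flip p w q = w q.
Proof. by rewrite ffunE => /negbTE->. Qed.

Lemma tprobD1 mu w p :
  tprob mu w = (if w p then mu p.1 else 1 - mu p.1) *
    \prod_(q | q != p) (if w q then mu q.1 else 1 - mu q.1).
Proof. by rewrite /tprob (bigD1 p). Qed.

Lemma tprob_ge0 mu w : (forall i : 'I_k, 0 <= mu i <= 1) -> 0 <= tprob mu w.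
Proof.
move=> mu01; apply: prodr_ge0 => p _; have := mu01 p.1.
by case: ifP => _ /andP[]; rewrite ?subr_ge0.
Qed.

Lemma sum_tprob mu : \sum_(w : table k T) tprob mu w = 1.
Proof.
rewrite /tprob -(bigA_distr_bigA (fun (p : 'I_k * 'I_T) (b : bool) =>
  if b then mu p.1 else 1 - mu p.1)) big1// => p _.
by rewrite big_bool /= subrKC.
Qed.

(* The involution flipping the bit about to be revealed pairs the two outcomes
   of the current pull, and leaves everything decided before it unchanged. *)
Lemma sum_tprob_reveal mu (A : table k T -> 'I_k * 'I_T)
    (U V : table k T -> R) :
  (forall w, A (flip (A w) w) = A w) ->
  (forall w, U (flip (A w) w) = U w) -> (forall w, V (flip (A w) w) = V w) ->
  \sum_w tprob mu w * (if w (A w) then U w else V w) =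
  \sum_w tprob mu w * (mu (A w).1 * U w + (1 - mu (A w).1) * V w).
Proof.
move=> Aflip Uflip Vflip.
pose h w := flip (A w) w.
have hK : involutive h by move=> w; rewrite /h Aflip flipK.
have sym (F : table k T -> R) : \sum_w F w = (\sum_w (F w + F (h w))) / 2.
  have e : \sum_w F (h w) = \sum_w F w.
    by rewrite [RHS](reindex_inj (inv_inj hK)).
  by rewrite big_split /= e; field.
rewrite sym [RHS]sym; congr (_ / 2); apply: eq_bigr => w _.
rewrite {1 2}/h !Aflip Uflip Vflip flip_same !(tprobD1 mu _ (A w)) flip_same.
under [X in _ + _ * X * _ = _]eq_bigr do rewrite flip_other//.
under [X in _ = _ + _ * X * _]eq_bigr do rewrite flip_other//.
by case: (w (A w)) => /=; ring.
Qed.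

End reward_table.

(** * Greedy's choice rule and its dependence on past rewards only *)

Lemma argbest_in (R : realType) (k : nat) (f : 'I_k -> R) x s :
  argbest f x s \in x :: s.
Proof.
rewrite /argbest; elim: s x => [|y s IH] x /=; first exact: mem_head.
by have := IH (if f x < f y then y else x); case: ifP => _;
  rewrite !inE => /orP[] ->; rewrite ?orbT.
Qed.

Lemma argbest_max (R : realType) (k : nat) (f : 'I_k -> R) x s y :
  y \in x :: s -> f y <= f (argbest f x s).
Proof.
rewrite /argbest; elim: s x y => [|z s IH] x y /=.
  by rewrite inE => /eqP->.
set b := if _ then _ else _.
have [xb zb] : f x <= f b /\ f z <= f b.
  by rewrite /b; case: ltP => // /ltW.
rewrite !inE => /or3P[/eqP->|/eqP->|ys].
- exact: le_trans xb (IH _ _ (mem_head _ _)).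
- exact: le_trans zb (IH _ _ (mem_head _ _)).
- by apply: IH; rewrite inE ys orbT.
Qed.

Section greedy_history.
Context {R : realType} {k T : nat}.
Implicit Types (s h : seq 'I_k) (w : table k T) (t : nat) (i j : 'I_k).

(** The value of [gnext] on a nonempty list of arms, freed of the [option]. *)
Definition gpull i0 s w t : 'I_k :=
  if (t < size (i0 :: s))%N then nth i0 (i0 :: s) t
  else argbest (emp R w (gacts R (i0 :: s) w t)) i0 s.

Lemma gactsS i0 s w t :
  gacts R (i0 :: s) w t.+1 = rcons (gacts R (i0 :: s) w t) (gpull i0 s w t).
Proof. by []. Qed.

Lemma size_gacts i0 s w t : size (gacts R (i0 :: s) w t) = t.
Proof. by elim: t => // t IH; rewrite gactsS size_rcons IH. Qed.

Lemma gpull_in i0 s w t : gpull i0 s w t \in i0 :: s.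
Proof. by rewrite /gpull; case: ifP => ?; [rewrite mem_nth | exact: argbest_in]. Qed.

Lemma gacts_initial i0 s w t : (t <= size (i0 :: s))%N ->
  gacts R (i0 :: s) w t = take t (i0 :: s).
Proof.
elim: t => [|t IH] ts; first by rewrite take0.
by rewrite gactsS IH 1?ltnW// /gpull ts (take_nth i0).
Qed.

Lemma mem_gacts i0 s w t i : (size (i0 :: s) <= t)%N -> i \in i0 :: s ->
  i \in gacts R (i0 :: s) w t.
Proof.
move=> + si; elim: t => // t IH; rewrite leq_eqVlt => /orP[/eqP <-|st].
  by rewrite gacts_initial// take_size.
by rewrite gactsS mem_rcons inE IH ?orbT.
Qed.

(** A finite substitute for the filtration: a quantity is known before round [t] when it takes equal
    values on tables that agree up to [t]. *)
Definition agree t w w' := forall i (u : 'I_T), (u < t)%N -> w (i, u) = w' (i, u).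

Lemma agree_flip (p : 'I_k * 'I_T) w t : (t <= p.2)%N -> agree t (flip p w) w.
Proof.
move=> tp i u ut; rewrite flip_other//; apply/eqP => ip.
by move: ut; rewrite -[u]/(i, u).2 ip ltnNge tp.
Qed.

Lemma agree_rew t w w' i u : agree t w w' -> (u < t)%N -> rew w i u = rew w' i u.
Proof. by move=> ag ut; rewrite /rew; case: insubP => // v _ vu; rewrite ag// vu. Qed.

(* The centred score [2 delta * pulls - failures] of arm i, so that an arm
   pulled at least once has empirical mean at least [1 - 2 delta] iff its score
   is nonnegative. *)
Definition score (delta : R) w h i : R :=
  \sum_(0 <= u < size h | nth i h u == i)
    ((rew w i u : nat)%:R - (1 - 2 * delta)).

Lemma agree_score delta t w w' h i : agree t w w' -> (size h <= t)%N ->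
  score delta w h i = score delta w' h i.
Proof.
move=> ag ht; rewrite /score big_nat_cond [RHS]big_nat_cond.
apply: eq_bigr => u /andP[/andP[_ uh] _]; congr (_%:R - _).
by rewrite (agree_rew _ _ _ _ _ ag)// (leq_trans uh).
Qed.

Lemma agree_gpull i0 s t w w' : agree t w w' ->
  gacts R (i0 :: s) w t = gacts R (i0 :: s) w' t ->
  gpull i0 s w t = gpull i0 s w' t.
Proof.
move=> ag hE; rewrite /gpull hE; case: ifP => // _; congr argbest.
apply/funext => i; rewrite /emp; congr (_ / _); apply: eq_bigr => u _.
by rewrite (agree_rew _ _ _ _ _ ag)// -[X in (_ < X)%N](size_gacts i0 s w').
Qed.

Lemma agree_gacts i0 s t w w' : agree t w w' ->
  gacts R (i0 :: s) w t = gacts R (i0 :: s) w' t.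
Proof.
elim: t => // t IH ag; have ag' : agree t w w' by move=> i u ut; apply/ag/ltnW.
by rewrite !gactsS IH// (agree_gpull _ _ _ _ _ ag')// IH.
Qed.

Lemma score_rcons delta w h a i : score delta w (rcons h a) i =
  score delta w h i + (if a == i then (rew w a (size h) : nat)%:R - (1 - 2 * delta) else 0).
Proof.
rewrite /score size_rcons big_mkcond big_nat_recr//= [in RHS]big_mkcond/=.
congr (_ + _); last by rewrite nth_rcons ltnn eqxx; case: eqP => [->|].
by apply: eq_big_nat => u /andP[_ uh]; rewrite nth_rcons uh.
Qed.

Lemma score_unpulled delta w h i : i \notin h -> score delta w h i = 0.
Proof.
move=> ih; rewrite /score big_nat_cond big_pred0// => u; apply/negbTE/negP.
by move=> /andP[/andP[_ uh] /eqP hu]; move: ih; rewrite -hu mem_nth.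
Qed.

Lemma score_emp delta w h i : i \in h ->
  (0 <= score delta w h i) = (1 - 2 * delta <= emp R w h i).
Proof.
move=> ih; rewrite /emp ler_pdivlMr; last by rewrite ltr0n -has_count has_pred1.
rewrite /score sumrB big_mkord subr_ge0; congr (_ <= _).
have <- : \sum_(j <- h | j == i) (1 - 2 * delta) =
    \sum_(0 <= u < size h | nth i h u == i) (1 - 2 * delta) by rewrite (big_nth i).
by rewrite big_const_seq iter_addr_0 mulr_natr.
Qed.

End greedy_history.

(** * The potential argument for fixed means *)

Section greedy_regret.
Context {R : realType} {k T : nat}.
Variables (mu : nat -> R) (delta : R) (i0 : 'I_k) (s : seq 'I_k).
Hypotheses (mu01 : forall i : 'I_k, 0 <= mu i <= 1).
Hypotheses (delta_ge0 : 0 <= delta) (delta_le : delta <= 1 / 6).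
Hypothesis arms_uniq : uniq (i0 :: s).
Implicit Types (sc : 'I_k -> R) (w : table k T) (t : nat) (a i : 'I_k).

(* Bounds the probability that arm i, good if its mean exceeds 1 - delta, ever
   gets a negative score from score sc i on; bad arms contribute nothing. *)
Definition die sc i : R := if 1 - delta < mu i then 1 - surv (sc i) else 1.
(* Dominates the indicator that a bad arm has nonnegative score. *)
Definition linger sc i : R :=
  if 3 * delta < 1 - mu i then expR (sc i / 2) else 0.
Definition all_die sc : R := \prod_(i <- i0 :: s) die sc i.
Definition all_linger sc : R := \sum_(i <- i0 :: s) 30 * linger sc i.
(** Bounds the expected cost still to come: each remaining round is charged [all_die + 3 * delta],
    and what bad arms cost beyond that is paid by [all_linger]. *)
Definition pot t sc : R := (T - t)%:R * (all_die sc + 3 * delta) + all_linger sc.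

Definition observe sc a (y : R) i : R :=
  sc i + (if a == i then y - (1 - 2 * delta) else 0).

Lemma die_ge0 sc i : 0 <= die sc i.
Proof. by rewrite /die; case: ifP => // _; rewrite subr_ge0 surv_le1. Qed.

Lemma all_die_ge0 sc : 0 <= all_die sc.
Proof. by apply: prodr_ge0 => i _; exact: die_ge0. Qed.

Lemma all_linger_ge0 sc : 0 <= all_linger sc.
Proof.
apply: sumr_ge0 => i _; rewrite mulr_ge0// /linger.
by case: ifP => // _; exact: expR_ge0.
Qed.

Lemma observe_other (f : ('I_k -> R) -> 'I_k -> R) sc a y :
  (forall sc' i, sc' i = sc i -> f sc' i = f sc i) ->
  forall i, i != a -> f (observe sc a y) i = f sc i.
Proof. by move=> fE i ia; apply: fE; rewrite /observe eq_sym (negbTE ia) addr0. Qed.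

(** Only the factor of [a] moves. For a good arm [surv_step] applies with failure probability
    [1 - mu a], below [delta]; otherwise the factor stays 1. *)
Lemma all_die_observe sc a : a \in i0 :: s ->
  mu a * all_die (observe sc a 1) + (1 - mu a) * all_die (observe sc a 0)
    <= all_die sc.
Proof.
move=> sa; have /andP[m0 m1] := mu01 a.
have E y : all_die (observe sc a y) =
    die (observe sc a y) a * \prod_(i <- i0 :: s | i != a) die sc i.
  rewrite /all_die (bigD1_seq a)//=; congr (_ * _); apply: eq_bigr => i ia.
  by apply: observe_other => // sc' j; rewrite /die => ->.
rewrite !E [all_die sc](bigD1_seq a)//= !mulrA -mulrDl.
apply: ler_wpM2r; first by apply: prodr_ge0 => i _; exact: die_ge0.
rewrite /die /observe eqxx; case: ifPn => good; last lra.
have := @surv_step R (1 - mu a) delta (sc a) _ delta_le.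
have -> : 1 - (1 - 2 * delta) = 2 * delta by ring.
have -> : 0 - (1 - 2 * delta) = 2 * delta - 1 by ring.
move=> h; have {}h := h ltac:(lra); lra.
Qed.

(** The weight 30 cancels the 1/30 of [pull_mgf_le], so the expected drop covers the cost of pulling
    a bad arm. *)
Lemma all_linger_observe sc a : a \in i0 :: s ->
  mu a * all_linger (observe sc a 1) + (1 - mu a) * all_linger (observe sc a 0)
    <= all_linger sc - (1 - mu a) * linger sc a.
Proof.
move=> sa; have /andP[m0 m1] := mu01 a.
have E y : all_linger (observe sc a y) = 30 * linger (observe sc a y) a +
    \sum_(i <- i0 :: s | i != a) 30 * linger sc i.
  rewrite /all_linger (bigD1_seq a)//=; congr (_ + _); apply: eq_bigr => i ia.
  congr (_ * _); apply: observe_other => // sc' j; by rewrite /linger => ->.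
rewrite !E [all_linger sc](bigD1_seq a)//=.
set rest := \sum_(_ <- _ | _) _.
suff : mu a * linger (observe sc a 1) a + (1 - mu a) * linger (observe sc a 0) a
    <= linger sc a * (1 - (1 - mu a) / 30) by lra.
rewrite /linger /observe eqxx; case: ifPn => bad; last lra.
have -> : (sc a + (1 - (1 - 2 * delta))) / 2 = sc a / 2 + delta by field.
have -> : (sc a + (0 - (1 - 2 * delta))) / 2 = sc a / 2 + (delta - 1 / 2) by field.
rewrite !(expRD (sc a / 2)) mulrCA [X in _ + X]mulrCA -mulrDr.
apply: ler_wpM2l; first exact: expR_ge0.
have := @pull_mgf_le R (1 - mu a) delta delta_ge0 bad ltac:(lra).
by rewrite opprB [1 + _]addrC subrK.
Qed.

Local Notation arms := (i0 :: s).
Local Notation hist w t := (gacts R arms w t).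
Local Notation sco w t := (score delta w (gacts R arms w t)).
Local Notation pull w t := (gpull (R := R) i0 s w t).

(* If some good arm has nonnegative score, then so has the greedily chosen arm. *)
Lemma pull_cost_le w t :
  1 - mu (pull w t) <= all_die (sco w t) + 3 * delta +
    (1 - mu (pull w t)) * linger (sco w t) (pull w t).
Proof.
set a := pull w t; have /andP[m0 m1] := mu01 a.
have D0 := all_die_ge0 (sco w t); have d0 := delta_ge0.
have ok : 0 <= sco w t a -> 1 - mu a <= all_die (sco w t) + 3 * delta +
    (1 - mu a) * linger (sco w t) a.
  move=> sa; rewrite /linger; case: ifPn => [_|]; last by rewrite -leNgt; lra.
  have e1 : 1 <= expR (sco w t a / 2) by rewrite -expR0 ler_expR divr_ge0.
  have := ler_wpM2l (ltac:(lra) : 0 <= 1 - mu a) e1; lra.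
have [ts|st] := ltnP t (size arms).
  (* In the initial rounds the arms are distinct, so the pulled one still has score 0. *)
  apply: ok; rewrite score_unpulled// gacts_initial ?(ltnW ts)//.
  rewrite /a /gpull ts; move: arms_uniq; rewrite -{1}(cat_take_drop t arms).
  rewrite cat_uniq => /and3P[_ /hasPn + _]; apply.
  by rewrite (drop_nth i0)// mem_head.
have [/hasP[j js /andP[jgood jscore]]|allneg] :=
    boolP (has (fun j : 'I_k => (1 - delta < mu j) && (0 <= sco w t j)) arms).
  apply: ok; rewrite score_emp ?mem_gacts ?gpull_in//.
  rewrite score_emp ?mem_gacts// in jscore.
  by apply: (le_trans jscore); rewrite /a /gpull ltnNge st /=; exact: argbest_max.
(* When all good arms have negative score, [surv] vanishes on each, and the resulting 1 covers any
   cost. *)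
suff -> : all_die (sco w t) = 1.
  have L0 : 0 <= linger (sco w t) a.
    by rewrite /linger; case: ifP => // _; exact: expR_ge0.
  have := mulr_ge0 (ltac:(lra) : 0 <= 1 - mu a) L0; lra.
rewrite /all_die big1_seq// => i /andP[_ si]; rewrite /die; case: ifPn => // good.
have /hasPn/(_ i si) := allneg; rewrite good /= -ltNge => /surv_neg ->.
by rewrite subr0.
Qed.

Lemma score_next w t (tT : (t < T)%N) : sco w t.+1 =
  observe (sco w t) (pull w t) (w (pull w t, Ordinal tT) : nat)%:R.
Proof.
apply/funext => i; rewrite gactsS score_rcons /observe size_gacts.
by rewrite /rew insubT.
Qed.

(** Passing from [T - t] to [T - t.+1] releases one copy of [all_die + 3 * delta]; together with the
    drop of [all_linger] it pays for the round by [pull_cost_le]. *)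
Lemma pot_step t : (t < T)%N ->
  \sum_w tprob (T := T) mu w * (1 - mu (pull w t) + pot t.+1 (sco w t.+1)) <=
  \sum_w tprob (T := T) mu w * pot t (sco w t).
Proof.
move=> tT; pose A w := (pull w t, Ordinal tT).
have ag w : agree t (flip (A w) w) w by apply: agree_flip.
have hE w : hist (flip (A w) w) t = hist w t by exact: agree_gacts (ag w).
have pE w : pull (flip (A w) w) t = pull w t by exact: agree_gpull (ag w) (hE w).
have sE w : sco (flip (A w) w) t = sco w t.
  by apply/funext => i; rewrite hE; apply: agree_score (ag w) _; rewrite size_gacts.
pose U y w := 1 - mu (pull w t) + pot t.+1 (observe (sco w t) (pull w t) y).
have UE y w : U y (flip (A w) w) = U y w by rewrite /U pE sE.
(* Given the past, the round depends on the single bit at [A w], so it can be averaged by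
   [sum_tprob_reveal]. *)
rewrite (eq_bigr (fun w => tprob mu w * (if w (A w) then U 1 w else U 0 w))).
  rewrite (sum_tprob_reveal mu A)//; last by move=> w; rewrite /A pE.
  apply: ler_sum => w _; apply: ler_wpM2l; first exact: tprob_ge0.
  rewrite /U /pot /A /=; set a := pull w t; set sc := sco w t.
  have sa : a \in arms by exact: gpull_in.
  have /andP[m0 m1] := mu01 a.
  have := pull_cost_le w t; rewrite -/a -/sc => cost.
  have := all_linger_observe sc a sa; have := all_die_observe sc a sa.
  rewrite -(subnSK tT) -[(T - t.+1).+1%:R]natr1.
  have : 0 <= (T - t.+1)%:R :> R by [].
  move: (T - t.+1)%:R (all_die _) (all_die _) (all_die sc) (all_linger _) (all_linger _) cost.
  move=> N D1 D2 D L1 L2 cost N0 /(ler_wpM2l N0) HD HL; lra.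
move=> w _; congr (_ * _); rewrite (score_next _ _ tT) -/(A w) /U.
by case: (w (A w)).
Qed.

(** Telescopes [pot_step] from zero scores, where [surv] is at least 1/5 and each [linger] at most
    1. Regret is measured against 1, an upper bound for the best mean. *)
Lemma regret_le : regret T mu arms <=
  T%:R * \prod_(i <- arms) (if 1 - delta < mu i then 4 / 5 else 1) +
    3 * delta * T%:R + 30 * (size arms)%:R.
Proof.
pose sc0 : 'I_k -> R := fun=> 0; have d0 := delta_ge0.
have pot_le t : (t <= T)%N ->
    \sum_w tprob (T := T) mu w *
      (\sum_(a <- hist w t) (1 - mu a) + pot t (sco w t)) <= pot 0 sc0.
  elim: t => [_|t IH tT].
    rewrite (eq_bigr (fun w => tprob mu w * pot 0 sc0)) => [|w _].
      by rewrite -mulr_suml sum_tprob mul1r.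
    rewrite big_nil add0r; congr (_ * pot _ _).
    by apply/funext => i; rewrite score_unpulled.
  apply: le_trans (IH (ltnW tT)); under eq_bigr do rewrite gactsS big_rcons/= -addrA mulrDr.
  under [leRHS]eq_bigr do rewrite mulrDr.
  by rewrite !big_split lerD2l pot_step.
have exp_rewE : exp_rew T mu arms = T%:R -
    \sum_w tprob (T := T) mu w * \sum_(a <- hist w T) (1 - mu a).
  rewrite -[T%:R]mul1r -(@sum_tprob R k T mu) mulr_suml -sumrB.
  apply: eq_bigr => w _; rewrite -mulrBr; congr (_ * _).
  rewrite sumrB big_const_seq iter_addr_0 count_predT size_gacts.
  by rewrite opprB addrCA subrr addr0.
have cost_le : \sum_w tprob (T := T) mu w * \sum_(a <- hist w T) (1 - mu a) <=
    pot 0 sc0.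
  apply: le_trans (pot_le T (leqnn T)); apply: ler_sum => w _.
  apply: ler_wpM2l; first exact: tprob_ge0.
  rewrite lerDl /pot addr_ge0 ?all_linger_ge0// mulr_ge0//.
  by rewrite addr_ge0 ?all_die_ge0//; lra.
have best_le : \big[Num.max/0]_(i < k) mu i <= 1.
  by apply: bigmax_le => // i _; have /andP[] := mu01 i.
rewrite /regret exp_rewE.
have := ler_wpM2l (ler0n R T) best_le.
suff : pot 0 sc0 <= T%:R * \prod_(i <- arms) (if 1 - delta < mu i then 4 / 5 else 1) +
    3 * delta * T%:R + 30 * (size arms)%:R by lra.
rewrite /pot subn0 mulrDr; apply: lerD; first (apply: lerD; last lra).
  apply: ler_wpM2l => //; apply: ler_prod => i _; rewrite die_ge0 /die /=.
  by case: ifP => // _; have := surv0 (R := R); rewrite /sc0; lra.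
rewrite /all_linger -mulr_sumr; apply: ler_wpM2l => //.
apply: (@le_trans _ _ (\sum_(i <- arms) 1)).
  by apply: ler_sum => i _; rewrite /linger /sc0 mul0r expR0; case: ifP.
by rewrite big_const_seq iter_addr_0 count_predT.
Qed.

End greedy_regret.

(** * The trivial regret bound, and integrals of threshold factors *)

Lemma exp_rew_ge0 (R : realType) (k T : nat) (mu : nat -> R) (s : seq 'I_k) :
  (forall i : 'I_k, 0 <= mu i <= 1) -> 0 <= exp_rew T mu s.
Proof.
move=> mu01; apply: sumr_ge0 => w _; rewrite mulr_ge0 ?tprob_ge0//.
by apply: sumr_ge0 => i _; have /andP[] := mu01 i.
Qed.

Lemma regret_le_horizon (R : realType) (k T : nat) (mu : nat -> R) (s : seq 'I_k) :
  (forall i : 'I_k, 0 <= mu i <= 1) -> regret T mu s <= T%:R.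
Proof.
move=> mu01; rewrite /regret lerBlDr; apply: ler_wpDr; first exact: exp_rew_ge0.
rewrite -[leRHS]mulr1 ler_wpM2l//.
by apply: bigmax_le => // i _; have /andP[] := mu01 i.
Qed.

Lemma measurable_gtr (R : realType) (a : R) : measurable [set x : R | a < x].
Proof.
rewrite (_ : [set x | _] = [set` `]a, +oo[]); first exact: measurable_itv.
by apply/seteqP; split => x /=; rewrite in_itv/= andbT.
Qed.

Lemma measurable_ger (R : realType) (a : R) : measurable [set x : R | a <= x].
Proof.
rewrite (_ : [set x | _] = [set` `[a, +oo[]); first exact: measurable_itv.
by apply/seteqP; split => x /=; rewrite in_itv/= andbT.
Qed.

Lemma measurable_fun_threshold (R : realType) (b : R) :
  measurable_fun setT (fun x : R => if b < x then 4 / 5 else 1 : R).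
Proof.
apply: measurable_fun_if => //.
by apply: measurable_fun_ltr.
Qed.

Lemma integral_threshold (R : realType) (P : probability R R) (b : R) :
  (\int[P]_x (if b < x then 4 / 5 else 1 : R)%:E)%E =
  (1 - fine (P [set x : R | (b < x)%R]) / 5)%:E.
Proof.
pose A := [set x : R | b < x].
have mA : measurable A by exact: measurable_gtr.
have fA : P A \is a fin_num by exact: fin_num_measure.
transitivity (\int[P]_x ((4 / 5)%:E + (1 / 5)%:E * (\1_(~` A) x)%:E))%E.
  apply: eq_integral => x _; rewrite indicE -EFinM -EFinD; congr EFin.
  case: ifPn => bx; first by rewrite memNset ?mulr0 ?addr0//; apply.
  by rewrite mem_set ?mulr1 => [|/= h]; [field | move: bx; rewrite h].
have mC : measurable (~` A) by exact: measurableC.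
rewrite ge0_integralD//=; last first.
  by apply: measurable_funeM; exact/measurable_EFinP.
rewrite integral_cst// [X in (_ * X + _)%E](probability_setT P) mule1.
rewrite ge0_integralZl//; last exact/measurable_EFinP.
rewrite integral_indic// setIT [X in (_ * X)%E](probability_setC P mA) -(fineK fA).
by rewrite -EFinB -EFinM -EFinD; congr EFin; field.
Qed.

(** Puts a product over a subset of arms into the all-coordinates form of [iint_le_sum_prod], with
    factor 1 outside the subset. *)
Lemma prod_set_mkord (R : realType) (k : nat) (S : {set 'I_k}) (f : nat -> R) :
  \prod_(j < k) (if (j : nat) \in [seq val i | i in S] then f j else 1) =
  \prod_(i in S) f i.
Proof.
rewrite [RHS]big_mkcond; apply: eq_bigr => j _.
by rewrite [X in if X then _ else _](fintype.mem_image val_inj).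
Qed.

Lemma sumr_draws (R : realType) (k m : nat) (x : R) :
  \sum_(S : {set 'I_k} | #|S| == m) x = x *+ 'C(k, m).
Proof. by rewrite sumr_const -[in RHS](card_ord k) -card_draws cardsE. Qed.

(** * Bayesian regret of SS-Greedy and Greedy *)

Section subsampled_greedy.
Context {R : realType} (P : probability R R).
Hypothesis P01 : P [set` `[0%R, 1%R]] = 1%E.

Lemma BR_ssgreedy_le_horizon (T k m : nat) : (m <= k)%N ->
  (BR_ssgreedy P T k m <= (T%:R)%:E)%E.
Proof.
move=> mk; have := @iint_le_sum_prod R P k unit
  (fun mu => ((\sum_(S : {set 'I_k} | #|S| == m) regret T mu (enum S))
       / ('C(k, m))%:R)%:E) T%:R (fun=> 0) (fun _ _ => cst 1) (fun _ _ => 1) P01.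
have sum0 (f : unit -> R) : T%:R + \sum_s 0 * f s = T%:R.
  by rewrite big1 ?addr0// => ? _; rewrite mul0r.
rewrite /= sum0; apply => //.
  by move=> _ _; rewrite integral_cst// [X in (_ * X)%E](probability_setT P) mule1.
move=> v v01; rewrite lee_fin ler_pdivrMr ?ltr0n ?bin_gt0// mulr_natr.
apply: (@le_trans _ _ (\sum_(S : {set 'I_k} | #|S| == m) T%:R)).
  by apply: ler_sum => S _; apply: regret_le_horizon => i; exact: v01.
by rewrite sumr_draws.
Qed.

Lemma BR_ssgreedy_le (c0 C0 : R) (T k m : nat) : 0 < c0 -> regular1 P c0 C0 ->
  (2 <= T)%N -> (0 < m <= k)%N -> 30 * ln T%:R / c0 <= m%:R ->
  (BR_ssgreedy P T k m <=
    (1 + 15 * T%:R * ln T%:R / (m%:R * c0) + 30 * m%:R)%:E)%E.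
Proof.
move=> c0_gt0 reg T2 /andP[m0 mk] mbig.
have lnT : 0 < ln (T%:R : R) by rewrite ln_gt0// ltr1n.
have m0R : 0 < m%:R :> R by rewrite ltr0n.
(* Chosen so that m c0 delta / 5 = log T; the lower bound on [m] then says exactly delta <= 1/6. *)
pose delta : R := 5 * ln T%:R / (m%:R * c0).
have delta0 : 0 < delta by rewrite divr_gt0 ?mulr_gt0.
have delta6 : delta <= 1 / 6.
  rewrite ler_pdivrMr ?mulr_gt0//; move: mbig; rewrite ler_pdivrMr//; lra.
pose die (x : R) : R := if 1 - delta < x then 4 / 5 else 1.
have die0 x : 0 <= die x by rewrite /die; case: ifP.
pose q : R := 1 - fine (P [set x : R | (1 - delta < x)%R]) / 5.
have qE : (\int[P]_x (die x)%:E)%E = q%:E by exact: integral_threshold.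
have q0 : 0 <= q by rewrite -lee_fin -qE; apply: integral_ge0 => x _; rewrite lee_fin.
have q_le : q <= expR (- (c0 * delta / 5)).
  apply: le_trans (expR_ge1Dx _); rewrite /q lerD2l lerN2 ler_pM2r ?invr_gt0//.
  have [+ _] := reg delta ltac:(lra).
  rewrite -[P _]fineK ?lee_fin//; apply: fin_num_measure; exact: measurable_gtr.
have Tq : T%:R * q ^+ m <= 1.
  have T0 : 0 < T%:R :> R by rewrite ltr0n (leq_trans _ T2).
  apply: (@le_trans _ _ (T%:R * expR (- (c0 * delta / 5)) ^+ m)).
    by rewrite ler_pM2l// lerXn2r ?nnegrE ?expR_ge0.
  rewrite -expRM_natl (_ : m%:R * _ = - ln T%:R).
    by rewrite expRN lnK ?posrE// mulfV// gt_eqF.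
  by rewrite /delta; field; rewrite !gt_eqF.
have C_gt0 : 0 < 'C(k, m)%:R :> R by rewrite ltr0n bin_gt0.
have card_eq (x : R) : \sum_(S : {set 'I_k} | #|S| == m) x = x * 'C(k, m)%:R.
  by rewrite sumr_draws mulr_natr.
(* Weight zero off size [m] lets the sum run over the finite type of all subsets. *)
pose dens (S : {set 'I_k}) : R := if #|S| == m then T%:R / 'C(k, m)%:R else 0.
pose c : R := 3 * delta * T%:R + 30 * m%:R.
have c_ge0 : 0 <= c.
  by rewrite /c; move: delta0; clearbody delta => d0; rewrite addr_ge0 ?mulr_ge0// ltW.
have := @iint_le_sum_prod R P k {set 'I_k}
  (fun mu => ((\sum_(S : {set 'I_k} | #|S| == m) regret T mu (enum S))
       / ('C(k, m))%:R)%:E) c dens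
  (fun S j x => if j \in [seq val i | i in S] then die x else 1)
  (fun S j => if j \in [seq val i | i in S] then q else 1) P01.
move=> h; apply: le_trans (h _ _ _ _ _ _) _ => {h}.
- exact: c_ge0.
- by move=> S; rewrite /dens; case: ifP.
- by move=> S j; case: (j \in _) => //; exact: measurable_fun_threshold.
- by move=> S j x; case: ifP.
- move=> S j; case: (j \in _) => //.
  by rewrite integral_cst// [X in (_ * X)%E](probability_setT P) mule1.
- move=> v v01; rewrite lee_fin ler_pdivrMr// mulrDl -card_eq mulr_suml.
  rewrite [X in _ <= _ + X](bigID (fun S : {set 'I_k} => #|S| == m)) /=.
  rewrite [X in _ <= _ + (_ + X)]big1 => [|S /negbTE Sm].
    rewrite addr0 -big_split /=; apply: ler_sum => S /eqP Sm.
    rewrite /dens Sm eqxx (prod_set_mkord _ _ S (fun j => die (v j))) mulrAC divfK ?gt_eqF//.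
    have v01' (i : 'I_k) : 0 <= v i <= 1 by exact: v01.
    have := @regret_le R k T v delta _ _ v01' (ltW delta0) delta6.
    have sz : size (enum S) = m by rewrite -cardE.
    have := enum_uniq S.
    case E : (enum S) sz => [|i0 s] /= sz; first by rewrite -sz in m0.
    move=> us /(_ i0 s us); rewrite -E -big_enum /= E sz /c /die; lra.
  by rewrite /dens Sm !mul0r.
under eq_bigr do rewrite (prod_set_mkord _ _ _ (fun=> q)) prodr_const.
rewrite (bigID (fun S : {set 'I_k} => #|S| == m)) /=.
rewrite [X in c + (_ + X)]big1 => [|S /negbTE Sm]; last first.
  by rewrite /dens Sm mul0r.
rewrite addr0 (eq_bigr (fun=> T%:R / 'C(k, m)%:R * q ^+ m)) => [|S /eqP Sm]; last first.
  by rewrite /dens Sm eqxx.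
rewrite card_eq mulrAC divfK ?gt_eqF// lee_fin /c.
have -> : 3 * delta * T%:R = 15 * T%:R * ln T%:R / (m%:R * c0).
  by rewrite /delta; field; rewrite !gt_eqF.
lra.
Qed.

(** The full set is the only subset of size [k], so one bound serves both claims. *)
Lemma BR_greedyE (T k : nat) : BR_greedy P T k = BR_ssgreedy P T k k.
Proof.
rewrite /BR_greedy /BR_ssgreedy; congr iint; apply/funext => mu.
rewrite (big_pred1 (setTfor 'I_k)) => [|S].
  by rewrite binn divr1 enum_setT enumT.
rewrite /= finset.eqEcard finset.subsetT cardsT card_ord eqn_leq.
by have := max_card (mem S); rewrite card_ord => ->.
Qed.

End subsampled_greedy.

(** * Fitting the constants of the two claims *)

Theorem theorem4 (R : realType) (P : probability R R) (c0 C0 : R) :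
  P `<< (@lebesgue_measure R) ->
  P [set` `[0%R, 1%R]] = 1%E ->
  0 < c0 -> c0 < C0 ->
  regular1 P c0 C0 ->
  let C1 := (1 - expR (-1)) / 2 in
  (forall T k : nat, (2 <= T)%N ->
     30 * ln (T%:R) / c0 <= k%:R ->
     (BR_greedy P T k <=
       (1 + 15 * T%:R * ln (T%:R) / (k%:R * c0)
        + 3 * C0 * k%:R / C1
          * (5 + ln (k%:R * c0 / 5) - ln (ln (T%:R))))%:E)%E) /\
  (forall a b : R, 0 < a -> 0 < b ->
     exists (A : R) (p T0 : nat), forall T k m : nat, (T0 <= T)%N ->
       a * Num.sqrt (T%:R) <= m%:R <= b * Num.sqrt (T%:R) -> (m <= k)%N ->
       (BR_ssgreedy P T k m <= (A * Num.sqrt (T%:R) * ln (T%:R) ^+ p)%:E)%E).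
Proof.
move=> _ P01 c0_gt0 _ reg C1.
have lnT_gt0 T : (2 <= T)%N -> 0 < ln (T%:R : R).
  by move=> T2; rewrite ln_gt0// ltr1n.
split=> [T k T2 kbig|a b a0 b0].
  have L0 := lnT_gt0 T T2.
  have k0R : 0 < k%:R :> R.
    by apply: lt_le_trans kbig; rewrite divr_gt0// mulr_gt0.
  have k0 : (0 < k)%N by rewrite ltr0n in k0R.
  rewrite BR_greedyE//.
  apply: le_trans (BR_ssgreedy_le _ P01 _ _ _ _ _ c0_gt0 reg T2 _ kbig) _ => //.
    by rewrite k0 leqnn.
  rewrite lee_fin lerD2l.
  (* Regularity at e = 1 bounds the whole mass 1 by [C0]. *)
  have C0_ge1 : 1 <= C0.
    have [_ [_]] := reg 1 ltac:(lra); rewrite mulr1 -lee_fin; apply: le_trans.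
    rewrite -P01; apply: le_measure; rewrite ?inE.
    - exact: measurable_itv.
    - exact: measurable_ger.
    - by move=> x /=; rewrite in_itv/= subrr => /andP[].
  have C1_gt0 : 0 < C1 by rewrite /C1; have := expRN1_le R; lra.
  have C1_le : C1 <= 1 / 2 by rewrite /C1; have := expR_ge0 (- 1 : R); lra.
  have log0 : ln (ln T%:R) <= ln (k%:R * c0 / 5).
    rewrite ler_ln ?posrE ?divr_gt0 ?mulr_gt0//.
    move: kbig; rewrite ler_pdivrMr//; lra.
  (* The term 30 k is split as 6 k times 5: the prefactor is at least 6 k, and the bracket at least
     5 by [log0]. *)
  have slope : 6 * k%:R <= 3 * C0 * k%:R / C1.
    rewrite ler_pdivlMr//; apply: (@le_trans _ _ (6 * k%:R * (1 / 2))).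
      by rewrite ler_pM2l// mulr_gt0.
    have := ler_wpM2r (ltW k0R) C0_ge1; lra.
  apply: (@le_trans _ _ (6 * k%:R * 5)); first lra.
  by apply: ler_pM => //; lra.
pose l : R := ln 2.
have l0 : 0 < l by exact: (lnT_gt0 2%N).
(* With r = sqrt T and L = log T, the first three summands absorb the three terms of
   [BR_ssgreedy_le], using r >= 1 and L >= l; the last is for [m] below its threshold. *)
exists (1 / l + 15 / (a * c0) + 30 * b / l + 30 / (a * c0)), 1%N, 2%N.
move=> T k m T2 /andP[am mb] mk; rewrite expr1.
have L0 := lnT_gt0 T T2; set L := ln T%:R in L0 *.
have lL : l <= L by rewrite ler_ln ?posrE ?ler_nat// ltr0n (leq_trans _ T2).
set r := Num.sqrt T%:R in am mb *.
have rr : T%:R = r * r by rewrite -expr2 sqr_sqrtr.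
have r1 : 1 <= r by rewrite -sqrtr1 ler_sqrt ?ler1n ?(leq_trans _ T2).
have r0 : 0 < r by lra.
have ac : 0 < a * c0 by rewrite mulr_gt0.
have Ll : 1 <= L / l by rewrite ler_pdivlMr// mul1r.
have rL : 0 <= r * L by rewrite mulr_ge0 ?ltW.
(* For small [m], a r <= m < 30 L / c0 makes r itself of order L, so the trivial bound T = r r
   suffices. *)
have [mbig|msmall] := leP (30 * L / c0) m%:R; last first.
  apply: le_trans (BR_ssgreedy_le_horizon _ P01 _ _ _ mk) _.
  rewrite lee_fin rr.
  have rs : r <= 30 / (a * c0) * L.
    move: msmall; rewrite ltr_pdivlMr// => msmall.
    rewrite mulrAC ler_pdivlMr//.
    have := ler_wpM2r (ltW c0_gt0) am; lra.
  have := ler_wpM2l (ltW r0) rs.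
  have p1 : 0 <= 1 / l * (r * L) by rewrite mulr_ge0// divr_ge0 ?ltW.
  have p2 : 0 <= 15 / (a * c0) * (r * L) by rewrite mulr_ge0// divr_ge0 ?ltW.
  have p3 : 0 <= 30 * b / l * (r * L) by rewrite mulr_ge0// divr_ge0 ?mulr_ge0 ?ltW.
  lra.
have m0R : 0 < m%:R :> R by apply: lt_le_trans am; rewrite mulr_gt0.
have m0 : (0 < m)%N by rewrite ltr0n in m0R.
apply: le_trans (BR_ssgreedy_le _ P01 _ _ _ _ _ c0_gt0 reg T2 _ mbig) _.
  by rewrite m0 mk.
rewrite lee_fin -/L rr.
have t1 : 1 <= 1 / l * (r * L).
  rewrite mulrCA mul1r [X in _ * X]mulrC; nra.
have t3 : 30 * m%:R <= 30 * b / l * (r * L).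
  apply: (@le_trans _ _ (30 * (b * r) * (L / l))); last lra.
  have := mulr_ge0 (ltW b0) (ltW r0); nra.
have t2 : 15 * (r * r) * L / (m%:R * c0) <= 15 / (a * c0) * (r * L).
  rewrite ler_pdivrMr ?mulr_gt0//.
  have -> : 15 / (a * c0) * (r * L) * (m%:R * c0) = 15 * (r * L) * (m%:R / a).
    by field; rewrite !gt_eqF.
  have -> : 15 * (r * r) * L = 15 * (r * L) * r by ring.
  apply: ler_wpM2l; first by rewrite mulr_ge0.
  by rewrite ler_pdivlMr// mulrC.
have t4 : 0 <= 30 / (a * c0) * (r * L) by rewrite mulr_ge0// divr_ge0 ?ltW.
lra.
Qed.
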